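(* Let $p\geq 2$ and let $G=(V,E)$ be a $2p$-regular graph admitting a $(p+2)$-star colouring $f$. Then every bicoloured component of $G$ under $f$ is isomorphic to $K_{1,p}$, and all colour classes $V_i=f^{-1}(i)$ have the same cardinality. Moreover, $f$ is both an equitable colouring and a fall colouring of $G$.
   Context: All graphs are finite and simple. A $k$-colouring of $G$ is a map $f:V(G)\to\{0,\dots,k-1\}$ with $f(u)\neq f(v)$ for every edge $uv$; it is a $k$-star colouring if no path on 4 vertices in $G$ receives only two colours. A bicoloured component of $G$ under $f$ is a connected component of $G[f^{-1}(i)\cup f^{-1}(j)]$ for some pair of distinct colours $i,j$. A colouring is equitable if the sizes of any two colour classes differ by at most one. A $k$-colouring is a fall colouring if every vertex has all $k$ colours present in its closed neighbourhood. *)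

(* Defs.v *)
From mathcomp Require Import all_boot.

Set Implicit Arguments.
Unset Strict Implicit.
Unset Printing Implicit Defensive.

Record sgraph := SGraph {
  vertex :> finType;
  edge : rel vertex;
  edge_sym : symmetric edge;
  edge_irrefl : irreflexive edge }.

Definition neighbours (G : sgraph) (v : G) : {set G} := [set u | edge v u].

Definition closed_neighbours (G : sgraph) (v : G) : {set G} :=
  v |: neighbours v.

Definition regular (d : nat) (G : sgraph) : Prop :=
  forall v : G, #|neighbours v| = d.

Definition isomorphic (G H : sgraph) : Prop :=
  exists2 h : G -> H, bijective h & forall u v : G, edge (h u) (h v) = edge u v.

Section Induced.
Variables (G : sgraph) (A : {set G}).

Definition induced_edge : rel {x : G | x \in A} :=
  fun u v => edge (val u) (val v).

Fact induced_edge_sym : symmetric induced_edge.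
Proof. by move=> u v; apply: edge_sym. Qed.

Fact induced_edge_irrefl : irreflexive induced_edge.
Proof. by move=> u; apply: edge_irrefl. Qed.

Definition induced : sgraph := SGraph induced_edge_sym induced_edge_irrefl.

End Induced.

Section CompleteBipartite.
Variables m n : nat.

Definition complete_bipartite_edge : rel ('I_m + 'I_n)%type :=
  fun u v => match u, v with
             | inl _, inr _ | inr _, inl _ => true
             | _, _ => false
             end.

Fact complete_bipartite_edge_sym : symmetric complete_bipartite_edge.
Proof. by case=> i [] j. Qed.

Fact complete_bipartite_edge_irrefl : irreflexive complete_bipartite_edge.
Proof. by case. Qed.

Definition complete_bipartite : sgraph :=
  SGraph complete_bipartite_edge_sym complete_bipartite_edge_irrefl.

End CompleteBipartite.

Definition is_component (G : sgraph) (C : {set G}) : Prop :=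
  exists x : G, C = [set y | connect (@edge G) x y].

Definition is_colouring (G : sgraph) (k : nat) (f : G -> 'I_k) : Prop :=
  forall u v : G, edge u v -> f u != f v.

(* The four-vertex paths are not required to be induced. *)
Definition is_star_colouring (G : sgraph) (k : nat) (f : G -> 'I_k) : Prop :=
  is_colouring f /\
  forall s : seq G, size s = 4 -> uniq s -> sorted (@edge G) s ->
    #|[set f x | x in s]| <> 2.

Definition colour_class (G : sgraph) (k : nat) (f : G -> 'I_k) (i : 'I_k) :
  {set G} := [set v | f v == i].

(* The bicoloured components of G under f are the components of the graphs
   [bicoloured_subgraph f i j] with i != j. *)
Definition bicoloured_subgraph (G : sgraph) (k : nat) (f : G -> 'I_k)
  (i j : 'I_k) : sgraph := induced (colour_class f i :|: colour_class f j).

Definition is_equitable_colouring (G : sgraph) (k : nat) (f : G -> 'I_k) :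
  Prop :=
  is_colouring f /\
  forall i j : 'I_k, #|colour_class f i| <= #|colour_class f j| + 1.

Definition is_fall_colouring (G : sgraph) (k : nat) (f : G -> 'I_k) : Prop :=
  is_colouring f /\
  forall (v : G) (i : 'I_k), exists2 u : G, u \in closed_neighbours v & f u = i.

(* Main.v *)
(* Call a neighbour v of u private when it is the only neighbour of u of its
   colour.  In a star colouring every edge uv has v private for u or u private
   for v, so on average a vertex has at least p private neighbours.  A vertex
   sees at most p+1 colours and has degree 2p > p+1, so it has at most p private
   neighbours.  Hence there are exactly p everywhere, the p other neighbours of u
   share one colour g u, and each edge uv satisfies exactly one of g u = f v,
   g v = f u.  The bicoloured components are therefore the stars with centre u
   and leaves the neighbours of u coloured g u.
   If c_ij vertices of V_i have g = j, then |V_i| = c_ij + p c_ji for i <> j;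
   summing over j gives sum_j c_ji = |V_i| = sum_j c_ij, and then summing
   |V_i| + |V_j| = (p+1)(c_ij + c_ji) over j gives |G| = (p+2)|V_i|. *)
Require Import Defs.
From mathcomp Require Import all_boot.
From mathcomp Require Import zify.

Set Implicit Arguments.
Unset Strict Implicit.
Unset Printing Implicit Defensive.

(** * Recognising stars *)

Lemma isomorphic_star (S : sgraph) (z : S) (p : nat) :
  #|[set~ z]| = p -> (forall w, w != z -> edge z w) ->
  (forall u v, u != z -> v != z -> ~~ edge u v) ->
  isomorphic S (complete_bipartite 1 p).
Proof.
move=> cardz edge_z nedge.
pose h (a : 'I_1 + 'I_p) : S :=
  match a with
  | inl _ => z
  | inr i => enum_val (cast_ord (esym cardz) i)
  end.
have hz i : h (inr i) != z.
  by have := enum_valP (cast_ord (esym cardz) i); rewrite !inE.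
have h_inj : injective h.
  move=> [a|i] [b|j] eq_h; first by rewrite (ord1 a) (ord1 b).
  - by case/eqP: (hz j); rewrite -eq_h.
  - by case/eqP: (hz i); rewrite eq_h.
  - by move: eq_h => /= /enum_val_inj /cast_ord_inj ->.
have h_bij : bijective h.
  apply: inj_card_bij h_inj _.
  by rewrite card_sum !card_ord -cardz cardsC1 add1n leqSpred.
have h_edge a b : edge (h a) (h b) = complete_bipartite_edge a b.
  case: a b => [a|i] [b|j].
  - exact: edge_irrefl.
  - by rewrite /= edge_z ?hz.
  - by rewrite edge_sym /= edge_z ?hz.
  - by apply: negbTE; apply: nedge.
case: h_bij => k hK kK; exists k; first by exists h.
by move=> u v; rewrite -{2}(kK u) -{2}(kK v) h_edge.
Qed.

(** By the last hypothesis a walk that leaves [z] can only come back to it, so [z] and its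
    neighbours already form the whole component. *)
Lemma component_star (H : sgraph) (C : {set H}) (z : H) :
  is_component C -> z \in C ->
  (forall w u, edge z w -> edge w u -> u = z) ->
  isomorphic (induced C) (complete_bipartite 1 #|neighbours z|).
Proof.
move=> [x defC] zC leafP.
have csym : connect_sym (@edge H) by apply: sym_connect_sym; apply: edge_sym.
have inC y : (y \in C) = (y == z) || edge z y.
  have -> : (y \in C) = connect (@edge H) z y.
    by move: zC; rewrite defC !inE => /(same_connect csym) ->.
  apply/idP/idP=> [|/orP[/eqP->|/connect1]//].
  case/connectP=> s + ->; elim/last_ind: s => [|s y' IHs]; first by rewrite eqxx.
  rewrite rcons_path last_rcons => /andP[/IHs/orP[/eqP->->|e1 e2]].
    by rewrite orbT.
  by rewrite (leafP _ _ e1 e2) eqxx.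
pose zC' : induced C := exist _ z zC.
apply: (@isomorphic_star _ zC').
- rewrite -(card_imset _ val_inj); apply: eq_card => y.
  apply/imsetP/idP=> [[w + ->]|].
    rewrite !inE -val_eqE /= => wz; move: (valP w).
    by rewrite inC (negbTE wz).
  rewrite inE => ezy; have yC : y \in C by rewrite inC ezy orbT.
  exists (exist _ y yC) => //; rewrite !inE -val_eqE /=.
  by apply: contraTneq ezy => ->; rewrite edge_irrefl.
- move=> w; rewrite -val_eqE /= => wz; move: (valP w).
  by rewrite inC (negbTE wz).
- move=> u v; rewrite -!val_eqE /= => uz vz; apply/negP=> euv.
  move: (valP u); rewrite inC (negbTE uz) /= => ezu.
  by rewrite (leafP _ _ ezu euv) eqxx in vz.
Qed.

(** * Colour degrees and the star condition at one edge *)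

Definition colour_degree (G : sgraph) (k : nat) (f : G -> 'I_k) (c : 'I_k)
  (u : G) : nat := #|[set v | edge u v & f v == c]|.

Section ColourDegree.
Variables (G : sgraph) (k : nat) (f : G -> 'I_k).
Implicit Types u v : G.

Lemma colour_degreeE c u : colour_degree f c u = \sum_(v | f v == c) edge u v.
Proof.
rewrite /colour_degree -sum1dep_card [RHS]big_mkcond [LHS]big_mkcond.
by apply: eq_bigr => v _; case: edge; case: eqP.
Qed.

Lemma colour_degree_gt0 u v : edge u v -> 0 < colour_degree f (f v) u.
Proof. by move=> euv; apply/card_gt0P; exists v; rewrite inE euv eqxx. Qed.

(** Neighbours are grouped by colour; the weight [F] will be the indicator of the private colours or
    of a single colour. *)
Lemma sum_edge_colour (F : 'I_k -> nat) u :
  \sum_v edge u v * F (f v) = \sum_c colour_degree f c u * F c.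
Proof.
rewrite (partition_big f xpredT) //=; apply: eq_bigr => c _.
by rewrite colour_degreeE big_distrl; apply: eq_bigr => v /eqP ->.
Qed.

Lemma sum_edge u : \sum_v edge u v = #|neighbours u|.
Proof.
rewrite -sum1dep_card [RHS]big_mkcond; apply: eq_bigr => v _.
by case: edge.
Qed.

Lemma sum_colour_degree u : \sum_c colour_degree f c u = #|neighbours u|.
Proof.
have := sum_edge_colour (fun=> 1) u.
under eq_bigr do rewrite muln1; under [RHS]eq_bigr do rewrite muln1.
by rewrite sum_edge => ->.
Qed.

Lemma colour_degree_self u : is_colouring f -> colour_degree f (f u) u = 0.
Proof.
move=> colf; apply/eqP; rewrite cards_eq0; apply/eqP/setP=> v; rewrite !inE.
by apply/negP=> /andP[/colf + /eqP fv]; rewrite fv eqxx.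
Qed.

(** Otherwise both colour degrees are at least 2, being positive because of the edge itself. A
    second neighbour [x] of [u] and [y] of [v] then extend the edge to a two-coloured path [x], [u],
    [v], [y]. *)
Lemma star_edge u v : is_star_colouring f -> edge u v ->
  (colour_degree f (f v) u == 1) || (colour_degree f (f u) v == 1).
Proof.
move=> [colf starf] euv; apply: contraT; rewrite negb_or => /andP[nu nv].
have other a b : edge a b -> colour_degree f (f b) a != 1 ->
    exists x, [/\ edge a x, f x = f b & x != b].
  move=> eab n1; have : 1 < colour_degree f (f b) a.
    by rewrite ltn_neqAle eq_sym n1 colour_degree_gt0.
  case/card_gt1P=> x [y []]; rewrite !inE => /andP[ex /eqP fx] /andP[ey /eqP fy].
  by have [->|xb _] := eqVneq x b; [exists y; rewrite eq_sym | exists x].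
have [x [eux fx xv]] := other _ _ euv nu.
have evu : edge v u by rewrite edge_sym.
have [y [evy fy yu]] := other _ _ evu nv.
have [fuv fvu] := (colf _ _ euv, colf _ _ evu).
have neq a b : f a != f b -> a != b by apply: contra_neq => ->.
case: (starf [:: x; u; v; y]) => //.
- by rewrite /= !inE !negb_or xv (eq_sym u y) yu
    !neq ?fx ?fy.
- by rewrite /= (edge_sym x) eux euv evy.
- transitivity #|[set f u; f v]|; last by rewrite cards2 fuv.
  apply: eq_card => c; apply/imsetP/set2P=> [[w]|].
    rewrite !inE => /or4P[] /eqP-> ->; rewrite ?fx ?fy; tauto.
  by case=> ->; [exists u | exists v]; rewrite // !inE eqxx ?orbT.
Qed.

End ColourDegree.

(** * Double counting of private neighbours *)

Section Regular.
Variables (p : nat) (G : sgraph) (f : G -> 'I_(p + 2)).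
Implicit Types u v w : G.
Hypotheses (hp : 2 <= p) (hG : regular (2 * p) G) (hf : is_star_colouring f).

(** Colours stand in for vertices: each of these colours belongs to exactly one neighbour of [u]. *)
Let private u := [set c | colour_degree f c u == 1].

Let private_sub u : private u \subset [set~ f u].
Proof.
apply/subsetP=> c; rewrite !inE; apply: contraTneq => ->.
by rewrite colour_degree_self //; case: hf.
Qed.

Let card_other_colours u : #|[set~ f u]| = p.+1.
Proof. by rewrite cardsC1 card_ord addn2. Qed.

Let sum_other_colours u : \sum_(c in [set~ f u]) colour_degree f c u = 2 * p.
Proof.
rewrite -(hG u) -(sum_colour_degree f) [RHS](bigD1 (f u)) //=.
rewrite colour_degree_self ?add0n; last by case: hf.
by apply: eq_bigl => c; rewrite !inE.
Qed.

Let sum_private u : \sum_(c in private u) colour_degree f c u = #|private u|.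
Proof. by rewrite -sum1_card; apply: eq_bigr => c; rewrite inE => /eqP. Qed.

Let card_private_le u : #|private u| <= p.
Proof.
rewrite -ltnS -(card_other_colours u) ltn_neqAle subset_leq_card // andbT.
apply/negP=> /eqP eqc.
have eqS : private u = [set~ f u] by apply/eqP; rewrite eqEcard private_sub eqc /=.
(* With all other colours private the degree would be [p.+1], which differs from [2 * p] because
   [2 <= p]. *)
have := sum_other_colours u; rewrite -eqS sum_private eqc card_other_colours.
lia.
Qed.

Let card_private u : #|private u| = p.
Proof.
have privE v : \sum_w edge v w * (colour_degree f (f w) v == 1) = #|private v|.
  rewrite (sum_edge_colour f (fun c => colour_degree f c v == 1)).
  rewrite -sum1dep_card [RHS]big_mkcond; apply: eq_bigr => c _.
  by case: eqP => [->|]; rewrite ?muln0.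
have lower : \sum_(v : G) p <= \sum_v #|private v|.
  suff : \sum_(v : G) \sum_w edge v w <= 2 * \sum_v #|private v|.
    under eq_bigr do rewrite sum_edge hG.
    by rewrite -big_distrr leq_pmul2l.
  (* Twice the total is a sum over ordered pairs plus its transpose, so [star_edge] gives the bound
     pair by pair. *)
  rewrite mul2n -addnn -(eq_bigr _ (fun v _ => privE v)).
  rewrite [X in _ <= _ + X]exchange_big -big_split leq_sum // => v _.
  rewrite -big_split leq_sum // => w _ /=.
  rewrite (edge_sym w v); case: (boolP (edge v w)) => // evw; rewrite !mul1n.
  by have := star_edge hf evw; do 2!case: (_ == 1).
(* The bound [p] holds at each vertex and the sums agree, so it is attained everywhere. *)
have [_ eq_sum] := leqif_sum (fun v (_ : true) => leqif_eq (card_private_le v)).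
move: eq_sum; rewrite eqn_leq lower leq_sum //.
by move/esym/forallP/(_ u)/eqP.
Qed.

Lemma hub_colour_ex u : exists c0, c0 != f u /\ forall c,
  colour_degree f c u = if c == f u then 0 else if c == c0 then p else 1.
Proof.
have : #|[set~ f u] :\: private u| == 1.
  by rewrite cardsDS // card_private card_other_colours subSnn.
case/cards1P=> c0 defc0.
have mem c : (c == c0) = (colour_degree f c u != 1) && (c != f u).
  by have /setP/(_ c) := defc0; rewrite !inE => ->.
have := mem c0; rewrite eqxx => /esym/andP[_ c0u]; exists c0; split=> // c.
have [->|cu] := eqVneq; first by rewrite colour_degree_self //; case: hf.
have [->|cc0] := eqVneq c c0; last first.
  by move: (mem c); rewrite (negbTE cc0) cu andbT => /esym/negbFE/eqP.
(* The [p] private neighbours leave [2 * p - p] neighbours for the one remaining colour [c0]. *)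
have := sum_other_colours u; rewrite (big_setID (private u)) /=.
rewrite (setIidPr (private_sub u)) sum_private card_private defc0 big_set1.
lia.
Qed.

(** The last clause is a second double count: each vertex has [p] neighbours coloured by its [g], so
    the two indicators sum to [2 * p * #|G|], the number of ordered adjacent pairs, while each pair
    contributes at most 1. *)
Lemma hub_colouring : exists g : G -> 'I_(p + 2),
  [/\ forall u, g u != f u,
      forall u c, colour_degree f c u =
        if c == f u then 0 else if c == g u then p else 1 &
      forall u v, edge u v -> (g u == f v) (+) (g v == f u)].
Proof.
have [g gP] := fin_all_exists hub_colour_ex.
have gf u : g u != f u by case: (gP u).
have degE u := (gP u).2.
exists g; split=> //.
have hubs u : \sum_v edge u v * (f v == g u) = p.
  rewrite (sum_edge_colour f (fun c => c == g u)) (bigD1 (g u)) //= eqxx muln1.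
  rewrite degE (negbTE (gf u)) eqxx big1 ?addn0 // => c /negbTE ->.
  by rewrite muln0.
pose F u v := edge u v * (f v == g u) + edge u v * (f u == g v).
have leF u v : F u v <= edge u v ?= iff (F u v == edge u v).
  apply: leqif_eq; rewrite /F; case: (boolP (edge u v)) => // euv.
  (* Both indicators cannot hold: neither colour degree in [star_edge] would then be 1, as [p] is
     not. *)
  have := star_edge hf euv; rewrite !degE !mul1n.
  have [fvu|_] := eqVneq (f v) (g u); have [fuv|_] := eqVneq (f u) (g v) => //.
  by do 2!case: ifP => _; lia.
have leFs u := leqif_sum (fun v (_ : true) => leF u v).
have [_ eq_sum] := leqif_sum (fun u (_ : true) => leFs u).
move: eq_sum.
have -> : \sum_u \sum_v F u v = \sum_(u : G) \sum_v edge u v.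
  under eq_bigr do rewrite big_split /=.
  rewrite big_split /= [X in _ + X]exchange_big /=.
  under [X in _ + X]eq_bigr => u _ do under eq_bigr do rewrite edge_sym.
  under eq_bigr do rewrite hubs.
  under [RHS]eq_bigr do rewrite sum_edge hG.
  by rewrite -big_distrr /= mul2n -addnn.
rewrite eqxx => /esym/forallP/= allF u v euv.
have /forallP/(_ v)/= := allF u; rewrite /F euv !mul1n.
by rewrite (eq_sym (g u)) (eq_sym (g v)); case: (f v == _); case: (f u == _).
Qed.

End Regular.

(** * Bicoloured stars and class sizes *)

Section Hubs.
Variables (p : nat) (G : sgraph) (f g : G -> 'I_(p + 2)).
Implicit Types u v w : G.
Hypothesis p_gt0 : 0 < p.
Hypothesis colf : is_colouring f.
Hypothesis gf : forall u, g u != f u.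
Hypothesis degE : forall u c, colour_degree f c u =
  if c == f u then 0 else if c == g u then p else 1.
Hypothesis edge_hub : forall u v, edge u v -> (g u == f v) (+) (g v == f u).

(** The number c_ij of the opening sketch. *)
Let hubs i j := \sum_(v | f v == i) (g v == j).

(** Let [v] have colour [i]. If [g v != j], its single neighbour [w] of colour [j] has [g w = i] by
    [edge_hub]; if [g v = j], no neighbour of colour [j] does. So [p * hubs j i] counts the [v] with
    [g v != j]. *)
Lemma card_class_hubs i j : i != j ->
  #|colour_class f i| = hubs i j + p * hubs j i.
Proof.
move=> ij.
have -> : p * hubs j i =
    \sum_(w | f w == j) \sum_(v | f v == i) edge v w * (g w == i).
  rewrite big_distrr; apply: eq_bigr => w /eqP fw.
  rewrite -big_distrl /=; under eq_bigr do rewrite edge_sym.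
  rewrite -colour_degreeE degE fw (negbTE ij) eq_sym.
  by case: eqP => _; rewrite ?muln0.
rewrite exchange_big /hubs -big_split -sum1dep_card /=.
apply: eq_bigr => v /eqP fv.
have -> : \sum_(w | f w == j) edge v w * (g w == i) =
    \sum_(w | f w == j) edge v w * (g v != j).
  apply: eq_bigr => w /eqP fw; case: (boolP (edge v w)) => // /edge_hub.
  by rewrite fv fw; do 2!case: (_ == _).
rewrite -big_distrl /= -colour_degreeE degE fv (eq_sym j) (negbTE ij) (eq_sym j).
by case: eqP; rewrite ?muln0.
Qed.

Lemma bicoloured_component i j (C : {set bicoloured_subgraph f i j}) :
  i != j -> is_component C ->
  isomorphic (induced C) (complete_bipartite 1 p).
Proof.
move=> ij compC; set H := bicoloured_subgraph f i j in C compC *.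
pose bi := colour_class f i :|: colour_class f j.
have fH (u : H) : (f (val u) == i) || (f (val u) == j).
  by have := valP u; rewrite !inE.
(* These are the centres of the stars: as [g] avoids [f], the value is the other of the two
   colours. *)
pose hub (u : H) := (g (val u) == i) || (g (val u) == j).
have leafP (z : H) : hub z -> forall w u : H, edge z w -> edge w u -> u = z.
  move=> hz w u ezw ewu; apply: val_inj.
  have [ezw' ewu'] : edge (val z) (val w) /\ edge (val w) (val u) by [].
  have := edge_hub ezw'; move: hz (fH z) (fH w) (fH u) (gf (val z)).
  move: (colf ezw') (colf ewu') => fzw fwu hz fz fw fu gz.
  have two a b c : (a == i) || (a == j) -> (b == i) || (b == j) ->
      (c == i) || (c == j) -> a != c -> b != c -> a = b.
    by do 3![case/orP=> /eqP->]; rewrite ?eqxx // eq_sym.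
  have -> : g (val z) = f (val w) by apply: (two _ _ _ hz fw fz); rewrite // eq_sym.
  have fuz : f (val u) = f (val z) by apply: (two _ _ _ fu fz fw); rewrite // eq_sym.
  (* The colour of [z] is not the hub colour of [w], so [w] has just one neighbour of that colour,
     and both [z] and [u] qualify. *)
  rewrite eqxx /= => gw.
  have : colour_degree f (f (val z)) (val w) == 1.
    by rewrite degE (negbTE fzw) (eq_sym (f _)) (negbTE gw).
  case/cards1P=> y /setP defy.
  have := defy (val u); have := defy (val z).
  rewrite !inE fuz eqxx ewu' (edge_sym (val w)) ezw' /=.
  by move=> /esym/eqP-> /esym/eqP->.
have card_hub (z : H) : hub z -> #|neighbours z| = p.
  move=> hz; have := degE (val z) (g (val z)).
  rewrite (negbTE (gf _)) eqxx => <-.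
  rewrite -(card_imset _ val_inj); apply: eq_card => y.
  apply/imsetP/idP=> [[w + ->]|].
    rewrite !inE => ezw; have ezw' : edge (val z) (val w) by [].
    rewrite ezw' /=; move: hz (fH z) (fH w) (gf (val z)) (colf ezw').
    by do 3![case/orP=> /eqP->]; rewrite ?eqxx // eq_sym.
  rewrite inE => /andP[ezy /eqP fy].
  have yH : y \in bi by rewrite !inE fy.
  by exists (exist _ y yH) => //; rewrite inE.
have [x defC] := compC.
have [z hz zC] : exists2 z, hub z & z \in C.
  have [hx|nhx] := boolP (hub x); first by exists x; rewrite // defC inE.
  (* A non-hub [x] is a leaf: its only neighbour of the other colour [c] is a hub by [edge_hub]. *)
  pose c := if f (val x) == i then j else i.
  have cbi : (c == i) || (c == j) by rewrite /c; case: ifP; rewrite eqxx ?orbT.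
  have cx : c != f (val x).
    by rewrite /c; case: (f _ =P i) => [->|/eqP]; rewrite eq_sym.
  have gc : g (val x) != c.
    by apply: contra nhx => /eqP gx; rewrite /hub gx.
  have : colour_degree f c (val x) == 1.
    by rewrite degE (negbTE cx) (eq_sym c) (negbTE gc).
  case/cards1P=> y /setP/(_ y); rewrite !inE eqxx => /andP[exy /eqP fy].
  have yH : y \in bi by rewrite !inE fy.
  exists (exist _ y yH); last by rewrite defC inE connect1.
  have := edge_hub exy; rewrite fy (negbTE gc) /= => /eqP gy.
  by rewrite /hub /= gy; apply: fH.
by rewrite -(card_hub z hz); apply: component_star compC zC (leafP z hz).
Qed.

Lemma card_class i : #|G| = (p + 2) * #|colour_class f i|.
Proof.
pose V j := #|colour_class f j|; rewrite -/(V i).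
have hubs0 j : hubs j j = 0.
  by apply: big1 => v /eqP <-; rewrite (negbTE (gf v)).
have out j : \sum_(l | l != j) hubs j l = V j.
  transitivity (\sum_l hubs j l); first by rewrite [RHS](bigD1 j) //= hubs0.
  rewrite exchange_big /V -sum1dep_card; apply: eq_bigr => v _.
  by rewrite (bigD1 (g v)) //= eqxx big1 // => l /negbTE; rewrite eq_sym => ->.
have numj : \sum_(j | j != i) 1 = p.+1.
  by rewrite sum1_card cardC1 card_ord addn2.
have sumV : \sum_j V j = #|G|.
  rewrite -sum1_card (partition_big f xpredT) //=; apply: eq_bigr => j _.
  by rewrite sum1dep_card.
have eq1 : p.+1 * V i = V i + p * \sum_(j | j != i) hubs j i.
  rewrite -numj big_distrl big_distrr -{2}(out i) -big_split /=.
  by apply: eq_bigr => j ji; rewrite mul1n [LHS](@card_class_hubs i j) // eq_sym.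
have eq2 : \sum_(j | j != i) V j =
    \sum_(j | j != i) hubs j i + p * \sum_(j | j != i) hubs i j.
  rewrite big_distrr -big_split; apply: eq_bigr => j ji.
  exact: card_class_hubs.
(* By [eq1] and [0 < p] the sum of the [hubs j i] is [V i], so the total is
   [V i + (V i + p * V i)]. *)
rewrite -sumV (bigD1 i) //= eq2 out.
nia.
Qed.

End Hubs.

Theorem theorem2 (p : nat) (hp : 2 <= p) (G : sgraph)
    (hG : regular (2 * p) G) (f : G -> 'I_(p + 2))
    (hf : is_star_colouring f) :
  (forall (i j : 'I_(p + 2)), i != j ->
     forall C : {set bicoloured_subgraph f i j}, is_component C ->
       isomorphic (induced C) (complete_bipartite 1 p)) /\
  (forall i j : 'I_(p + 2), #|colour_class f i| = #|colour_class f j|) /\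
  is_equitable_colouring f /\
  is_fall_colouring f.
Proof.
have p_gt0 : 0 < p by apply: ltnW.
have [g [gf degE edge_hub]] := hub_colouring hp hG hf.
have [colf _] := hf.
have class_eq i j : #|colour_class f i| = #|colour_class f j|.
  have := card_class p_gt0 gf degE edge_hub i.
  rewrite (card_class p_gt0 gf degE edge_hub j) => /eqP.
  by rewrite eqn_pmul2l ?addn2 // => /eqP.
split; last split; [|exact: class_eq|split].
- move=> i j ij C compC; exact: bicoloured_component.
- by split=> // i j; rewrite (class_eq i j) leq_addr.
- split=> // v i; have [fv|fv] := eqVneq (f v) i.
    by exists v; rewrite // !inE eqxx.
  have : 0 < colour_degree f i v.
    by rewrite degE eq_sym (negbTE fv); case: ifP.
  case/card_gt0P=> u; rewrite inE => /andP[evu /eqP fu].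
  by exists u; rewrite // !inE evu orbT.
Qed.
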